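(* Fix $\kappa>0$. If $A\in C^0(\mathbb{R},\mathrm{SL}(2,\mathbb{R}))\cap C^2(\mathbb{R},\mathbb{M}^2)$ is a solution of $\ddot A(t)+\kappa A(t)=\lambda(t)\,\mathrm{cof}\,A(t)$ such that $|A|$ is nonconstant and $T$-periodic for some $T>0$, then the solution has the form $$A(t)=U\left(\tfrac12(\omega_1+\omega_2)t\right)\hat A(t)\,U\left(\tfrac12(\omega_1-\omega_2)t\right),$$ where $\hat A(t)$ is $T$-periodic if $A(t)\notin\mathrm{SO}(2,\mathbb{R})$ for all $t\in\mathbb{R}$, and $2T$-periodic if $A(t)\in\mathrm{SO}(2,\mathbb{R})$ for some $t\in\mathbb{R}$. The frequencies are defined by $$\omega_1=\frac1T\int_0^T\frac{X_3}{\frac12|A(t)|^2+1}\,dt,\qquad \omega_2=\begin{cases}0,&X_2=0,\\[2pt]\displaystyle\frac1T\int_0^T\frac{X_2}{\frac12|A(t)|^2-1}\,dt,&X_2\ne0,\end{cases}$$ where $X_i=X_i(A,\dot A)$, $i=2,3$ (these quantities are constant in time).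
   Context: $\mathbb{M}^2$ is the space of real $2\times2$ matrices with inner product $\langle A,B\rangle=\mathrm{tr}(A^\top B)$ and norm $|A|=\langle A,A\rangle^{1/2}$. $\mathrm{SL}(2,\mathbb{R})=\{A:\det A=1\}$; $\mathrm{SO}(2,\mathbb{R})$ is the rotation group. $Z=\begin{bmatrix}0&-1\\1&0\end{bmatrix}$, $U(\theta)=\cos\theta\,I+\sin\theta\,Z$, and $\mathrm{cof}\,A=ZAZ^\top$ is the cofactor matrix. $X_2(A,B)=\tfrac12\langle ZA-AZ,B\rangle$, $X_3(A,B)=\tfrac12\langle ZA+AZ,B\rangle$. A solution means that the equation holds for some $\lambda\in C^0(\mathbb{R},\mathbb{R})$ (necessarily $\lambda(t)=2(\kappa-\det\dot A(t))/|A(t)|^2$). If $X_2\neq0$ then $A(t)\notin\mathrm{SO}(2,\mathbb{R})$, i.e. $|A(t)|^2>2$, for all $t$. *)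

(* Defs.v *)
From HB Require Import structures.
From mathcomp Require Import all_boot all_order all_algebra.
From mathcomp Require Import all_classical all_reals all_analysis.

Set Implicit Arguments.
Unset Strict Implicit.
Unset Printing Implicit Defensive.

Import Order.TTheory GRing.Theory Num.Theory.
Import numFieldNormedType.Exports.

Local Open Scope ring_scope.

Definition mxdot (R : realType) (A B : 'M[R]_2) : R := \tr (A^T *m B).

(* The norm of M^2 is the Euclidean one, whereas the library's `|A| on
   matrices is the maximum norm; both induce the same topology, so the
   library's derivative and continuity apply as they are. *)
Definition mxnorm (R : realType) (A : 'M[R]_2) : R := Num.sqrt (mxdot A A).

Definition SL2 (R : realType) (A : 'M[R]_2) : Prop := \det A = 1.

Definition SO2 (R : realType) (A : 'M[R]_2) : Prop :=
  A^T *m A = 1%:M /\ \det A = 1.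

(* The matrix [[0, -1], [1, 0]]. *)
Definition Zmx (R : realType) : 'M[R]_2 :=
  \matrix_(i < 2, j < 2) ((i > j)%N%:R - (i < j)%N%:R).

Definition Umx (R : realType) (theta : R) : 'M[R]_2 :=
  cos theta *: 1%:M + sin theta *: Zmx R.

Definition cofmx (R : realType) (A : 'M[R]_2) : 'M[R]_2 :=
  Zmx R *m A *m (Zmx R)^T.

Definition X2 (R : realType) (A B : 'M[R]_2) : R :=
  2^-1 * mxdot (Zmx R *m A - A *m Zmx R) B.

Definition X3 (R : realType) (A B : 'M[R]_2) : R :=
  2^-1 * mxdot (Zmx R *m A + A *m Zmx R) B.

Definition C2 (R : realType) (A : R -> 'M[R]_2) : Prop :=
  [/\ forall t, derivable A t 1,
      forall t, derivable (derive1 A) t 1 &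
      continuous (derive1n 2 A)].

Definition is_solution (R : realType) (kappa : R) (A : R -> 'M[R]_2) : Prop :=
  exists2 lambda : R -> R, continuous lambda &
    forall t, derive1n 2 A t + kappa *: A t = lambda t *: cofmx (A t).

Definition omega1 (R : realType) (A : R -> 'M[R]_2) (T : R) : R :=
  T^-1 * \int[lebesgue_measure]_(t in `[0, T]%classic)
    (X3 (A t) (derive1 A t) / (2^-1 * mxnorm (A t) ^+ 2 + 1)).

(* X2 (A t) (A' t) does not depend on t along a solution, so the case
   distinction may be made at t = 0. *)
Definition omega2 (R : realType) (A : R -> 'M[R]_2) (T : R) : R :=
  if X2 (A 0) (derive1 A 0) == 0 then 0
  else T^-1 * \int[lebesgue_measure]_(t in `[0, T]%classic)
    (X2 (A t) (derive1 A t) / (2^-1 * mxnorm (A t) ^+ 2 - 1)).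

(* Main.v *)
Require Import Defs.
From mathcomp Require Import all_boot all_order all_algebra.
From mathcomp Require Import all_classical all_reals all_analysis.
From mathcomp Require Import ring lra.
Set Implicit Arguments.
Unset Strict Implicit.
Unset Printing Implicit Defensive.

Import Order.TTheory GRing.Theory Num.Theory.
Import numFieldNormedType.Exports.
Local Open Scope ring_scope.

(** Write a 2x2 matrix as [A = P + Q], where [P = a I + b Z] commutes with [Z]
    and [Q = c K + d L], [K = diag(1, -1)], [L = [[0, 1], [1, 0]]],
    anticommutes with it, and regard [p = (a, b)] and [q = (c, d)] as curves in
    the plane. In these coordinates
    - [cof A = P - Q] and [det A = |p|^2 - |q|^2], so the equation becomes
      [p'' = (lambda - kappa) p], [q'' = - (lambda + kappa) q];
    - [|A|^2 / 2 + 1 = 2 |p|^2] and [|A|^2 / 2 - 1 = 2 |q|^2] on SL(2), so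
      [|p|] and [|q|] are [T]-periodic and [A] is in SO(2) exactly when [q = 0];
    - [X3 = 2 (a b' - b a')] and [X2 = 2 (c d' - d c')], which are conserved
      because both equations are central;
    - [U(alpha) A U(beta)] rotates [p] by [alpha + beta] and [q] by
      [alpha - beta].
    The claim is thus that [p] in the frame rotating with frequency [omega1] is
    [T]-periodic, and that [q] in the frame rotating with frequency [omega2] is
    [T]-periodic or [2T]-periodic.

    A plane curve that never vanishes has a polar angle whose derivative is its
    angular momentum over its squared norm. If the momentum is constant and the
    norm is [T]-periodic, the angle thus increases over every period by the
    integral of that quotient over [[0, T]] ([angular_shift]). This settles [p],
    and [q] when it has no zero.

    If [q] vanishes at [t0], then [X2 = 0] and [omega2 = 0]. The coefficient
    [lambda] is [T]-periodic, since it can be recovered from [|p|^2], its two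
    derivatives and [X3]. So [q] and its translate by [T] solve the same
    linear second order equation and both vanish at [t0]. The curve stays on
    the line spanned by [q'(t0)], and [|q'(t0 + T)| = |q'(t0)|]; hence
    [q'(t0 + T)] is [q'(t0)] or its opposite, and by uniqueness
    [q(t + T)] is [q(t)] for all [t] or [- q(t)] for all [t]. In both cases [q]
    is [2T]-periodic ([ode2_double_period]). *)

(** * Differentiation of real functions *)

Lemma is_derive_add (R : realType) (f g : R -> R) (x df dg : R) :
  is_derive x 1 f df -> is_derive x 1 g dg ->
  is_derive x 1 (fun t => f t + g t) (df + dg).
Proof. exact: is_deriveD. Qed.

Lemma is_derive_opp (R : realType) (f : R -> R) (x df : R) :
  is_derive x 1 f df -> is_derive x 1 (fun t => - f t) (- df).
Proof. exact: is_deriveN. Qed.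

Lemma is_derive_mul (R : realType) (f g : R -> R) (x df dg : R) :
  is_derive x 1 f df -> is_derive x 1 g dg ->
  is_derive x 1 (fun t => f t * g t) (df * g x + f x * dg).
Proof.
move=> hf hg; have := is_deriveM hf hg.
by rewrite /GRing.scale /= addrC [g x * _]mulrC.
Qed.

Lemma is_derive_comp (R : realType) (f g : R -> R) (x df dg : R) :
  is_derive (g x) 1 f df -> is_derive x 1 g dg ->
  is_derive x 1 (fun t => f (g t)) (df * dg).
Proof. exact: is_derive1_comp. Qed.

Lemma is_derive_const (R : realType) (k x : R) :
  is_derive x 1 (fun _ : R => k) 0.
Proof. exact: is_derive_cst. Qed.

Lemma is_derive_translate (R : realType) (f : R -> R) (T x df : R) :
  is_derive (x + T) 1 f df -> is_derive x 1 (fun t => f (t + T)) df.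
Proof.
move=> hf; rewrite -[df]mulr1.
exact: (@is_derive_comp R f (fun t => t + T) x df 1 hf (is_derive_shift x 1 T)).
Qed.

Lemma is_derive_invr (R : realType) (f : R -> R) (x df : R) : f x != 0 ->
  is_derive x 1 f df -> is_derive x 1 (fun t => (f t)^-1) (- df / f x ^+ 2).
Proof.
move=> fx hf; have := is_deriveV fx hf.
by rewrite /GRing.scale /= mulNr mulrC mulNr.
Qed.

Lemma is_derive_sqrtr (R : realType) (f : R -> R) (x df : R) : 0 < f x ->
  is_derive x 1 f df ->
  is_derive x 1 (fun t => Num.sqrt (f t)) (df / (2 * Num.sqrt (f x))).
Proof.
move=> fx hf; rewrite mulrC.
exact: (@is_derive_comp _ Num.sqrt f _ _ _ (is_derive1_sqrt fx) hf).
Qed.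

Lemma sum_sqr_eq0 (R : realType) (x y : R) : x * x + y * y = 0 -> x = 0 /\ y = 0.
Proof.
move=> /eqP; rewrite -!expr2 paddr_eq0 ?sqr_ge0// !sqrf_eq0.
by move=> /andP[/eqP-> /eqP->].
Qed.

(** [der] proves [is_derive x 1 f l] for [f] built from functions whose
    derivatives are hypotheses, and leaves the equation between the computed
    derivative and [l]. *)
Ltac der_rec :=
  match goal with
  | |- is_derive _ _ (fun t => @?f t + @?g t) _ =>
      eapply (@is_derive_add _ f g); der_rec
  | |- is_derive _ _ (fun t => - @?f t) _ =>
      eapply (@is_derive_opp _ f); der_rec
  | |- is_derive _ _ (fun t => @?f t * @?g t) _ =>
      eapply (@is_derive_mul _ f g); der_rec
  | |- is_derive _ _ (fun t => cos (@?f t)) _ =>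
      eapply (@is_derive_comp _ (fun x => cos x) f); [exact: is_derive_cos|der_rec]
  | |- is_derive _ _ (fun t => sin (@?f t)) _ =>
      eapply (@is_derive_comp _ (fun x => sin x) f); [exact: is_derive_sin|der_rec]
  | |- is_derive _ _ (fun t => expR (@?f t)) _ =>
      eapply (@is_derive_comp _ (fun x => expR x) f); [exact: is_derive_expR|der_rec]
  | |- is_derive _ _ (fun t => t) _ => exact: is_derive_id
  | |- is_derive _ _ (fun t => ?f (t + ?T)) _ =>
      eapply (@is_derive_translate _ f T); der_rec
  | H : forall t, is_derive t 1 ?f _ |- is_derive _ _ (fun t => ?f t) _ => apply: H
  | H : forall t, is_derive t 1 ?f _ |- is_derive _ _ ?f _ => apply: H
  | H : is_derive ?x 1 ?f _ |- is_derive ?x _ (fun t => ?f t) _ => apply: H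
  | H : is_derive ?x 1 ?f _ |- is_derive ?x _ ?f _ => apply: H
  | |- is_derive _ _ (fun _ => ?k) _ => exact: is_derive_const
  end.
Ltac der := eapply is_derive_eq; [der_rec | cbn beta].

Section ScalarODE.
Variable R : realType.
Implicit Types (f g h u v : R -> R) (a b s t x T : R).

Lemma is_derive_continuous f f1 :
  (forall t, is_derive t 1 f (f1 t)) -> continuous f.
Proof.
move=> df t; apply/differentiable_continuous/derivable1_diffP.
by case: (df t).
Qed.

Lemma is_derive_unique f x a b : is_derive x 1 f a -> is_derive x 1 f b -> a = b.
Proof. by move=> [_ <-] [_ <-]. Qed.

Lemma periodic_derive f f1 T : (forall t, is_derive t 1 f (f1 t)) ->
  periodic f T -> periodic f1 T.
Proof.
move=> df fT t; apply: (@is_derive_unique (fun s => f (s + T)) t).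
  by apply: is_derive_translate.
by rewrite (_ : (fun s => _) = f)//; apply/funext => s; exact: fT.
Qed.

Lemma mean_value f f1 a b : a <= b ->
  (forall t, a <= t <= b -> is_derive t 1 f (f1 t)) ->
  exists2 c, a <= c <= b & f b - f a = f1 c * (b - a).
Proof.
move=> ab df.
case: (@MVT_segment R f f1 a b ab) => [c|t|c + ->].
- by rewrite in_itv/= => /andP[/ltW ac /ltW cb]; apply: df; rewrite ac.
- apply: derivable_within_continuous => {}t; rewrite in_itv/= => tab.
  by case: (df t tab).
- by rewrite in_itv/= => cab; exists c.
Qed.

Lemma derive0_eq f a b : a <= b ->
  (forall t, a <= t <= b -> is_derive t 1 f 0) -> f a = f b.
Proof.
move=> ab df; have [c _] := mean_value ab df.
by rewrite mul0r => /eqP; rewrite subr_eq0 => /eqP.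
Qed.

(** The derivative is two-sided at both endpoints: the primitive is taken from
    [-1], and [f] is continuous beyond [T]. *)
Lemma continuous_primitive f T : 0 < T -> continuous f ->
  exists2 F : R -> R, (forall t, 0 <= t <= T -> is_derive t 1 F (f t)) &
    \int[lebesgue_measure]_(t in `[0, T]%classic) f t = F T - F 0.
Proof.
move=> T0 cf.
pose F x := (\int[lebesgue_measure]_(t in [set` `[(-1 : R), x]%R]) f t)%R.
have dF t : 0 <= t <= T -> is_derive t 1 F (f t).
  move=> /andP[t0 tT].
  have tT1 : t < T + 1 by lra.
  have cfi : lebesgue_measure.-integrable `[(-1 : R), T + 1]%classic (EFin \o f).
    apply: continuous_compact_integrable; first exact: segment_compact.
    exact: continuous_subspaceT.
  have lt1 : -1 < t by lra.
  have [dFt eFt] := continuous_FTC1_closed tT1 cfi lt1 (cf t).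
  by rewrite -eFt derive1E; exact/derivableP.
exists F => //.
rewrite /Rintegral (@continuous_FTC2 _ f F 0 T) //.
- exact: continuous_subspaceT.
- have cF t : 0 <= t <= T -> {for t, continuous F}.
    move=> /dF[dFt _]; exact/differentiable_continuous/derivable1_diffP.
  split.
  + by move=> t; rewrite in_itv/= => /andP[/ltW t0 /ltW tT]; case: (dF t); rewrite ?t0.
  + by apply: cvg_at_right_filter; apply: cF; lra.
  + by apply: cvg_at_left_filter; apply: cF; lra.
- move=> t; rewrite in_itv/= => /andP[/ltW t0 /ltW tT].
  by rewrite derive1E; case: (dF t); rewrite ?t0.
Qed.

(** * Uniqueness for linear differential equations *)

(** The square norm of a solution of [u' = - f v], [v' = f u] is constant, so a
    solution that vanishes at one end of an interval vanishes at the other. *)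
Lemma rotation_ode_zero f u v a b : a <= b ->
  (forall t, a <= t <= b -> is_derive t 1 u (- (f t * v t))) ->
  (forall t, a <= t <= b -> is_derive t 1 v (f t * u t)) ->
  (u a = 0 /\ v a = 0) <-> (u b = 0 /\ v b = 0).
Proof.
move=> ab du dv.
have E : u a * u a + v a * v a = u b * u b + v b * v b.
  apply: (@derive0_eq (fun t => u t * u t + v t * v t)) => // t tab.
  by have := du t tab; have := dv t tab => dvt dut; der; ring.
by split=> -[x0 y0]; move: E; rewrite x0 y0 => E; split; nra.
Qed.

(** Over one period of the angular velocity [f] a solution turns by the integral
    of [f]: the translate by [T] and the solution rotated by that angle solve the
    same equation, and they agree at time 0. *)
Lemma rotation_ode_shift f u v T : 0 < T -> continuous f -> periodic f T ->
  (forall t, is_derive t 1 u (- (f t * v t))) ->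
  (forall t, is_derive t 1 v (f t * u t)) ->
  let J := \int[lebesgue_measure]_(t in `[0, T]%classic) f t in
  forall t, u (t + T) = cos J * u t - sin J * v t /\
            v (t + T) = sin J * u t + cos J * v t.
Proof.
move=> T0 cf fT du dv J; rewrite {}/J.
have [F dF ->] := continuous_primitive T0 cf; set J := F T - F 0.
pose p t := u (t + T) - (cos J * u t - sin J * v t).
pose q t := v (t + T) - (sin J * u t + cos J * v t).
have dp t : is_derive t 1 p (- (f t * q t)).
  by rewrite /p /q; der; rewrite fT; ring.
have dq t : is_derive t 1 q (f t * p t).
  by rewrite /p /q; der; rewrite fT; ring.
have pq0 : p 0 = 0 /\ q 0 = 0.
  (* On [0, T] the solution is its value at 0 rotated by [F t - F 0]. *)
  pose p' t := u t - (cos (F t - F 0) * u 0 - sin (F t - F 0) * v 0).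
  pose q' t := v t - (sin (F t - F 0) * u 0 + cos (F t - F 0) * v 0).
  have dp' t : 0 <= t <= T -> is_derive t 1 p' (- (f t * q' t)).
    by move=> /dF dFt; rewrite /p' /q'; der; ring.
  have dq' t : 0 <= t <= T -> is_derive t 1 q' (f t * p' t).
    by move=> /dF dFt; rewrite /p' /q'; der; ring.
  have [+ _] := rotation_ode_zero (ltW T0) dp' dq'.
  rewrite /p' /q' /p /q add0r subrr cos0 sin0; apply.
  by split; ring.
move=> t.
have [p0 q0] : p t = 0 /\ q t = 0.
  have [t0|/ltW t0] := leP 0 t;
    have [fwd bwd] := rotation_ode_zero t0 (fun s _ => dp s) (fun s _ => dq s).
    exact: fwd.
  exact: bwd.
by split; apply/eqP; rewrite -subr_eq0; apply/eqP.
Qed.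

(** Gronwall's argument for [E = f^2 + f'^2], which satisfies
    [|E'| <= K E] on every segment, with [K] depending on the segment. *)
Lemma ode2_zero h f f1 t0 : continuous h ->
  (forall t, is_derive t 1 f (f1 t)) ->
  (forall t, is_derive t 1 f1 (h t * f t)) ->
  f t0 = 0 -> f1 t0 = 0 -> forall t, f t = 0 /\ f1 t = 0.
Proof.
move=> ch df df1 f0 f10.
pose E t := f t * f t + f1 t * f1 t.
have step a b : a <= b -> (E a = 0) <-> (E b = 0).
  move=> ab.
  have [|c _ hc] := @EVT_max R (fun t => `|h t|) a b ab.
    apply: continuous_subspaceT => x.
    exact: continuous_comp (ch x) (@norm_continuous _ _ _).
  have hK t : a <= t <= b -> `|2 * (f t * f1 t) * (1 + h t)| <= (1 + `|h c|) * E t.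
    move=> tab; have htc : `|h t| <= `|h c| by apply: hc; rewrite in_itv.
    rewrite mulrC normrM ler_pM//.
      by rewrite (le_trans (ler_normD _ _))// normr1 lerD2l.
    have := sqr_ge0 (f t - f1 t); have := sqr_ge0 (f t + f1 t).
    by rewrite /E ler_norml => ? ?; apply/andP; split; lra.
  set K := 1 + `|h c| in hK *.
  have dE t : is_derive t 1 E (2 * (f t * f1 t) * (1 + h t)).
    by rewrite /E; der; ring.
  have E0 t : 0 <= E t by rewrite /E; nra.
  have eKt t : 0 < expR (K * t) := expR_gt0 _.
  have eNKt t : 0 < expR (- (K * t)) := expR_gt0 _.
  split=> Ez.
    have [t|s sab] := @mean_value (fun t => E t * expR (- (K * t)))
      (fun t => (2 * (f t * f1 t) * (1 + h t) - K * E t) * expR (- (K * t))) _ _ ab.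
      by move=> _; der; ring.
    have := hK s sab; rewrite ler_norml => /andP[_ hs].
    rewrite Ez mul0r subr0 => eq1.
    have : E b * expR (- (K * b)) <= 0.
      by rewrite eq1 mulr_le0_ge0 ?subr_ge0// mulr_le0_ge0 ?subr_le0 ?expR_ge0.
    rewrite pmulr_lle0// => Eb; apply/eqP; rewrite eq_le Eb E0//.
  have [t|s sab] := @mean_value (fun t => E t * expR (K * t))
    (fun t => (2 * (f t * f1 t) * (1 + h t) + K * E t) * expR (K * t)) _ _ ab.
    by move=> _; der; ring.
  have := hK s sab; rewrite ler_norml => /andP[hs _].
  rewrite Ez mul0r sub0r => eq1.
  have : E a * expR (K * a) <= 0.
    rewrite -oppr_ge0 eq1 mulr_ge0 ?subr_ge0// mulr_ge0 ?expR_ge0//.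
    by rewrite -lerBlDr sub0r.
  by rewrite pmulr_lle0// => Ea; apply/eqP; rewrite eq_le Ea E0.
move=> t; suff Et : E t = 0 by move: Et; rewrite /E => Et; split; nra.
have Et0 : E t0 = 0 by rewrite /E f0 f10; ring.
have [tt|/ltW tt] := leP t0 t; first exact/(step _ _ tt).
exact/(step _ _ tt).
Qed.
End ScalarODE.

(** * Plane curves with periodic norm *)

Section PlaneCurves.
Variable R : realType.
Implicit Types (h u v c d : R -> R) (s t T X : R).

(** The unit curve [(u, v) / r] turns with the angular velocity [X / m], where
    [m = r^2] is the squared norm of the curve and [X] its angular momentum. *)
Lemma angular_shift u v u1 v1 X T : 0 < T ->
  (forall t, is_derive t 1 u (u1 t)) -> (forall t, is_derive t 1 v (v1 t)) ->
  (forall t, 0 < u t * u t + v t * v t) ->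
  periodic (fun t => u t * u t + v t * v t) T ->
  (forall t, u t * v1 t - v t * u1 t = X) ->
  let J := \int[lebesgue_measure]_(t in `[0, T]%classic)
             (X / (u t * u t + v t * v t)) in
  forall t, u (t + T) = cos J * u t - sin J * v t /\
            v (t + T) = sin J * u t + cos J * v t.
Proof.
move=> T0 du dv m0 mT uvX J t.
pose m s := u s * u s + v s * v s.
pose r s : R := Num.sqrt (m s).
have r0 s : r s != 0 by rewrite lt0r_neq0// sqrtr_gt0; apply: m0.
have rr s : m s = r s * r s by rewrite -expr2 sqr_sqrtr// ltW//; apply: m0.
have rT : periodic r T by move=> s; rewrite /r /m mT.
have dm s : is_derive s 1 m (2 * (u s * u1 s + v s * v1 s)).
  by rewrite /m; der; ring.
have dr s : is_derive s 1 r ((u s * u1 s + v s * v1 s) / r s).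
  have := @is_derive_sqrtr _ m _ _ (m0 s) (dm s).
  by rewrite -/(r s) -mulf_div divff ?mul1r.
have dir s : is_derive s 1 (fun x => (r x)^-1)
    (- ((u s * u1 s + v s * v1 s) / r s) / r s ^+ 2) := is_derive_invr (r0 s) (dr s).
have dun s : is_derive s 1 (fun x => u x / r x) (- (X / m s * (v s / r s))).
  der; transitivity ((m s * u1 s - u s * (u s * u1 s + v s * v1 s)) / r s ^+ 3).
    by rewrite rr; field; apply: r0.
  by rewrite -(uvX s) [in RHS]rr /m; field; apply: r0.
have dvn s : is_derive s 1 (fun x => v x / r x) (X / m s * (u s / r s)).
  der; transitivity ((m s * v1 s - v s * (u s * u1 s + v s * v1 s)) / r s ^+ 3).
    by rewrite rr; field; apply: r0.
  by rewrite -(uvX s) [in RHS]rr /m; field; apply: r0.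
have cf : continuous (fun s => X / m s).
  apply: (@is_derive_continuous _ _ (fun s => _)) => s.
  apply: (is_derive_mul (is_derive_const _ _) (is_derive_invr _ (dm s))).
  by rewrite gt_eqF//; apply: m0.
have fT : periodic (fun s => X / m s) T by move=> s; rewrite /m mT.
have [] := rotation_ode_shift T0 cf fT dun dvn t.
rewrite -/J rT => eu ev.
have rt := r0 t; split.
- by rewrite -[LHS](divfK rt) eu; field.
- by rewrite -[LHS](divfK rt) ev; field.
Qed.

(** A solution of a central linear equation that vanishes somewhere moves on a
    line; if moreover its norm is [T]-periodic, then translation by [T]
    multiplies it by a sign [e]. *)
Lemma ode2_double_period h c d c1 d1 T t0 : continuous h -> periodic h T ->
  (forall t, is_derive t 1 c (c1 t)) -> (forall t, is_derive t 1 d (d1 t)) ->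
  (forall t, is_derive t 1 c1 (h t * c t)) ->
  (forall t, is_derive t 1 d1 (h t * d t)) ->
  periodic (fun t => c t * c t + d t * d t) T ->
  c t0 = 0 -> d t0 = 0 ->
  periodic c (2 * T) /\ periodic d (2 * T).
Proof.
move=> ch hT dc dd dc1 dd1 nT ct0 dt0.
have dn t : is_derive t 1 (fun t => c t * c t + d t * d t)
    (2 * (c t * c1 t + d t * d1 t)) by der; ring.
have dn1 t : is_derive t 1 (fun t => 2 * (c t * c1 t + d t * d1 t))
    (2 * (c1 t * c1 t + d1 t * d1 t + h t * (c t * c t + d t * d t))) by der; ring.
have n2T := periodic_derive dn1 (periodic_derive dn nT).
(* The second derivative of the squared norm is [T]-periodic, and at [t0] it
   equals [2 |(c1, d1)|^2]. *)
have speed : c1 (t0 + T) * c1 (t0 + T) + d1 (t0 + T) * d1 (t0 + T) =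
    c1 t0 * c1 t0 + d1 t0 * d1 t0.
  by have := n2T t0; rewrite hT (nT t0) ct0 dt0; lra.
(* The motion stays on the line spanned by the velocity at [t0]. *)
have [_ cross] : c (t0 + T) * d1 t0 - d (t0 + T) * c1 t0 = 0 /\
    c1 (t0 + T) * d1 t0 - d1 (t0 + T) * c1 t0 = 0.
  apply: (@ode2_zero _ h (fun t => c t * d1 t0 - d t * c1 t0)
    (fun t => c1 t * d1 t0 - d1 t * c1 t0) t0) => // [t|t||].
  - by der; ring.
  - by der; ring.
  - by rewrite ct0 dt0; ring.
  - by ring.
(* Parallel vectors of equal norm agree up to sign. *)
have [e [ee ec ed]] : exists e,
    [/\ e * e = 1, c1 (t0 + T) = e * c1 t0 & d1 (t0 + T) = e * d1 t0].
  have [N0|N0] := eqVneq (c1 t0 * c1 t0 + d1 t0 * d1 t0) 0.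
    exists 1; move: speed; rewrite N0 => speed.
    have [-> ->] := sum_sqr_eq0 speed; have [-> ->] := sum_sqr_eq0 N0.
    by split; ring.
  exists ((c1 (t0 + T) * c1 t0 + d1 (t0 + T) * d1 t0) /
          (c1 t0 * c1 t0 + d1 t0 * d1 t0)).
  split.
  - set D := _ + d1 t0 * d1 t0 in N0 *.
    set P := _ + d1 (t0 + T) * d1 t0.
    have : P * P = D * D.
      transitivity (P * P + (c1 (t0 + T) * d1 t0 - d1 (t0 + T) * c1 t0) ^+ 2).
        by rewrite cross expr0n addr0.
      transitivity ((c1 (t0 + T) * c1 (t0 + T) + d1 (t0 + T) * d1 (t0 + T)) * D).
        by rewrite /P /D; ring.
      by rewrite speed.
    by move=> PP; rewrite mulf_div PP divff// mulf_neq0.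
  - apply: (mulIf N0); rewrite mulrAC divfK//.
    apply/eqP; rewrite -subr_eq0; apply/eqP.
    transitivity ((c1 (t0 + T) * d1 t0 - d1 (t0 + T) * c1 t0) * d1 t0); first by ring.
    by rewrite cross mul0r.
  - apply: (mulIf N0); rewrite mulrAC divfK//.
    apply/eqP; rewrite -subr_eq0; apply/eqP.
    transitivity (- (c1 (t0 + T) * d1 t0 - d1 (t0 + T) * c1 t0) * c1 t0); first by ring.
    by rewrite cross oppr0 mul0r.
have n0 : c (t0 + T) * c (t0 + T) + d (t0 + T) * d (t0 + T) = 0.
  by rewrite (nT t0) ct0 dt0; ring.
have shift f f1 : (forall t, is_derive t 1 f (f1 t)) ->
    (forall t, is_derive t 1 f1 (h t * f t)) -> f t0 = 0 -> f (t0 + T) = 0 ->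
    f1 (t0 + T) = e * f1 t0 -> periodic f (2 * T).
  move=> df df1 f0 fT0 f1T.
  have fT t : f (t + T) = e * f t.
    have [] // : f (t + T) - e * f t = 0 /\ f1 (t + T) - e * f1 t = 0; last first.
      by move=> /eqP; rewrite subr_eq0 => /eqP.
    apply: (@ode2_zero _ h (fun t => f (t + T) - e * f t)
      (fun t => f1 (t + T) - e * f1 t) t0) => // [s|s||].
    - by der; ring.
    - by der; rewrite hT; ring.
    - by rewrite f0 fT0; ring.
    - by rewrite f1T; ring.
  move=> t; rewrite (_ : t + 2 * T = t + T + T); last by ring.
  by rewrite !fT mulrA ee mul1r.
have [cT0 dT0] := sum_sqr_eq0 n0.
by split; [apply: (shift c c1)|apply: (shift d d1)].
Qed.
End PlaneCurves.

(** * Conformal and anticonformal coordinates of a matrix *)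

Section Coordinates.
Variable R : realType.
Implicit Types (a b c d x y al be th om t T : R) (A B : 'M[R]_2).

(** The matrix [a I + b Z + c K + d L], with [K = diag(1, -1)] and
    [L = [[0, 1], [1, 0]]]. *)
Definition cmx a b c d : 'M[R]_2 := \matrix_(i < 2, j < 2)
  (if i == ord0 then if j == ord0 then a + c else d - b
   else if j == ord0 then b + d else a - c).

Lemma mx2P A B : A ord0 ord0 = B ord0 ord0 -> A ord0 ord_max = B ord0 ord_max ->
  A ord_max ord0 = B ord_max ord0 -> A ord_max ord_max = B ord_max ord_max -> A = B.
Proof.
move=> e00 e01 e10 e11; apply/matrixP => i j.
have ordE (k : 'I_2) : k = ord0 \/ k = ord_max.
  by case: k => [[|[|//]] hk]; [left|right]; apply: val_inj.
by have [->|->] := ordE i; have [->|->] := ordE j.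
Qed.

(** The two components of the vector [(x, y)] rotated by the angle [th]. *)
Definition rot1 th x y := cos th * x - sin th * y.
Definition rot2 th x y := sin th * x + cos th * y.

(** The coordinates of a matrix in the basis [I], [Z], [K], [L]; see
    [cmx_coord]. *)
Definition ca A := (A ord0 ord0 + A ord_max ord_max) / 2.
Definition cb A := (A ord_max ord0 - A ord0 ord_max) / 2.
Definition cc A := (A ord0 ord0 - A ord_max ord_max) / 2.
Definition cd A := (A ord_max ord0 + A ord0 ord_max) / 2.

Lemma sum2 (F : 'I_2 -> R) : \sum_i F i = F ord0 + F ord_max.
Proof.
by rewrite !big_ord_recl big_ord0 addr0; congr (_ + F _); apply: val_inj.
Qed.

Lemma cmx_coord A : cmx (ca A) (cb A) (cc A) (cd A) = A.
Proof. by apply: mx2P; rewrite !mxE /= /ca /cb /cc /cd; field. Qed.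

Lemma Zmx_cmx : Zmx R = cmx 0 1 0 0.
Proof. by apply: mx2P; rewrite !mxE /= ?mulr0n ?mulr1n ?addr0 ?subr0. Qed.

Lemma mul_cmx a b c d a' b' c' d' : cmx a b c d *m cmx a' b' c' d' =
  cmx (a * a' - b * b' + c * c' + d * d') (a * b' + b * a' + d * c' - c * d')
      (a * c' - b * d' + c * a' + d * b') (a * d' + b * c' - c * b' + d * a').
Proof. by apply: mx2P; rewrite !mxE sum2 !mxE /=; ring. Qed.

Lemma tr_cmx a b c d : (cmx a b c d)^T = cmx a (- b) c d.
Proof. by apply: mx2P; rewrite !mxE /=; ring. Qed.

Lemma add_cmx a b c d a' b' c' d' : cmx a b c d + cmx a' b' c' d' =
  cmx (a + a') (b + b') (c + c') (d + d').
Proof. by apply: mx2P; rewrite !mxE /=; ring. Qed.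

Lemma opp_cmx a b c d : - cmx a b c d = cmx (- a) (- b) (- c) (- d).
Proof. by apply: mx2P; rewrite !mxE /=; ring. Qed.

Lemma Umx_cmx th : Umx th = cmx (cos th) (sin th) 0 0.
Proof. by apply: mx2P; rewrite /Umx Zmx_cmx !mxE /=; ring. Qed.

Lemma mxdot_cmx a b c d a' b' c' d' : mxdot (cmx a b c d) (cmx a' b' c' d') =
  2 * (a * a' + b * b' + c * c' + d * d').
Proof. by rewrite /mxdot tr_cmx mul_cmx /mxtrace sum2 !mxE /=; ring. Qed.

Lemma det_cmx a b c d : \det (cmx a b c d) = a * a + b * b - c * c - d * d.
Proof.
rewrite (expand_det_row _ ord0) sum2 /cofactor !det_mx11 !mxE /=.
by rewrite /= ?addn0 expr0 expr1; ring.
Qed.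

Lemma rot_cmx al be a b c d : Umx al *m cmx a b c d *m Umx be =
  cmx (rot1 (al + be) a b) (rot2 (al + be) a b)
      (rot1 (al - be) c d) (rot2 (al - be) c d).
Proof.
rewrite !Umx_cmx !mul_cmx /rot1 /rot2 !(sinD, cosD) cosN sinN.
by congr cmx; ring.
Qed.


Lemma ca_cmx a b c d : ca (cmx a b c d) = a.
Proof. by rewrite /ca !mxE /=; field. Qed.
Lemma cb_cmx a b c d : cb (cmx a b c d) = b.
Proof. by rewrite /cb !mxE /=; field. Qed.
Lemma cc_cmx a b c d : cc (cmx a b c d) = c.
Proof. by rewrite /cc !mxE /=; field. Qed.
Lemma cd_cmx a b c d : cd (cmx a b c d) = d.
Proof. by rewrite /cd !mxE /=; field. Qed.

Lemma cofmx_coord A : cofmx A = cmx (ca A) (cb A) (- cc A) (- cd A).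
Proof.
rewrite /cofmx -{1}(cmx_coord A) Zmx_cmx tr_cmx !mul_cmx.
by congr cmx; ring.
Qed.

Lemma X2_coord A B : X2 A B = 2 * (cc A * cd B - cd A * cc B).
Proof.
rewrite /X2 -{1 2}(cmx_coord A) -{1}(cmx_coord B) Zmx_cmx !mul_cmx.
by rewrite opp_cmx add_cmx mxdot_cmx; field.
Qed.

Lemma X3_coord A B : X3 A B = 2 * (ca A * cb B - cb A * ca B).
Proof.
rewrite /X3 -{1 2}(cmx_coord A) -{1}(cmx_coord B) Zmx_cmx !mul_cmx.
by rewrite add_cmx mxdot_cmx; field.
Qed.

Lemma SL2_coord A :
  SL2 A -> ca A * ca A + cb A * cb A = 1 + (cc A * cc A + cd A * cd A).
Proof. by rewrite /SL2 -{1}(cmx_coord A) det_cmx => h; lra. Qed.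

Lemma mxnorm_coord A : mxnorm A ^+ 2 =
  2 * (ca A * ca A + cb A * cb A + cc A * cc A + cd A * cd A).
Proof.
rewrite /mxnorm -{1 2}(cmx_coord A) mxdot_cmx sqr_sqrtr//.
by rewrite -!expr2 mulr_ge0// !addr_ge0// sqr_ge0.
Qed.

Lemma SO2_coord A : SL2 A -> SO2 A <-> cc A * cc A + cd A * cd A = 0.
Proof.
move=> sA; have eA := SL2_coord sA; split=> [[AtA _]|q0].
  have : mxdot A A = 2 by rewrite /mxdot AtA mxtrace1.
  by rewrite -{1 2}(cmx_coord A) mxdot_cmx => h; lra.
have [c0 d0] := sum_sqr_eq0 q0; split=> //.
rewrite -(cmx_coord A) c0 d0 tr_cmx mul_cmx.
rewrite q0 addr0 in eA.
have -> : 1%:M = cmx 1 0 0 0.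
  by apply: mx2P; rewrite !mxE /= ?mulr0n ?mulr1n ?addr0 ?subr0.
by congr cmx; lra.
Qed.

Lemma mul_UmxN th : Umx th *m Umx (- th) = 1%:M.
Proof.
rewrite !Umx_cmx mul_cmx cosN sinN.
have -> : 1%:M = cmx 1 0 0 0.
  by apply: mx2P; rewrite !mxE /= ?mulr0n ?mulr1n ?addr0 ?subr0.
by rewrite -(cos2Dsin2 th); congr cmx; ring.
Qed.

Lemma is_derive_coord (F : R -> 'M[R]_2) t : derivable F t 1 ->
  [/\ is_derive t 1 (fun s => ca (F s)) (ca (derive1 F t)),
      is_derive t 1 (fun s => cb (F s)) (cb (derive1 F t)),
      is_derive t 1 (fun s => cc (F s)) (cc (derive1 F t)) &
      is_derive t 1 (fun s => cd (F s)) (cd (derive1 F t))].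
Proof.
move=> dF.
have dFij i j : is_derive t 1 (fun s => F s i j) (derive1 F t i j).
  rewrite derive1E (derive_mx dF) mxE.
  exact/derivableP/(derivable_mxP F t 1).1.
have d00 := dFij ord0 ord0; have d01 := dFij ord0 ord_max.
have d10 := dFij ord_max ord0; have d11 := dFij ord_max ord_max.
by split; rewrite /ca /cb /cc /cd; der; field.
Qed.

(** A curve which turns by [om * T] over each time [T] is [T]-periodic in the
    frame that rotates with frequency [om]. *)
Lemma rotating_frame_periodic (u v : R -> R) T om :
  (forall t, u (t + T) = cos (om * T) * u t - sin (om * T) * v t /\
             v (t + T) = sin (om * T) * u t + cos (om * T) * v t) ->
  periodic (fun t => rot1 (- (om * t)) (u t) (v t)) T /\
  periodic (fun t => rot2 (- (om * t)) (u t) (v t)) T.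
Proof.
move=> uv; have cs := cos2Dsin2 (om * T).
split=> t; rewrite /rot1 /rot2 mulrDr opprD cosD sinD !cosN !sinN;
  have [-> ->] := uv t;
  set x := u t; set y := v t; set p := cos (om * t); set q := sin (om * t).
- transitivity ((cos (om * T) ^+ 2 + sin (om * T) ^+ 2) * (p * x - - q * y)).
    by ring.
  by rewrite cs mul1r.
- transitivity ((cos (om * T) ^+ 2 + sin (om * T) ^+ 2) * (- q * x + p * y)).
    by ring.
  by rewrite cs mul1r.
Qed.

End Coordinates.

(** * Periodicity in the rotating frame *)

Unset Implicit Arguments.

Theorem theorem11p6 (R : realType) (kappa : R) (A : R -> 'M[R]_2) (T : R)
    (kappa_gt0 : 0 < kappa)
    (A_SL2 : forall t, SL2 (A t))
    (A_C0 : continuous A)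
    (A_C2 : C2 A)
    (A_sol : is_solution kappa A)
    (T_gt0 : 0 < T)
    (normA_nonconst : ~ exists c : R, forall t, mxnorm (A t) = c)
    (normA_periodic : periodic (fun t => mxnorm (A t)) T) :
  (forall t, X2 (A t) (derive1 A t) = X2 (A 0) (derive1 A 0)) /\
  (forall t, X3 (A t) (derive1 A t) = X3 (A 0) (derive1 A 0)) /\
  exists Ahat : R -> 'M[R]_2,
    (forall t, A t = Umx (2^-1 * (omega1 A T + omega2 A T) * t) *m Ahat t
                     *m Umx (2^-1 * (omega1 A T - omega2 A T) * t)) /\
    ((forall t, ~ SO2 (A t)) -> periodic Ahat T) /\
    ((exists t, SO2 (A t)) -> periodic Ahat (2 * T)).
Proof.
have [lambda clambda sol] := A_sol.
have [dA dA1 _] := A_C2.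
(* [p = (a, b)], [q = (c, d)], and the coefficients of [p'' = hp p] and
   [q'' = hq q]. *)
pose a (t : R) := ca (A t); pose b (t : R) := cb (A t).
pose c (t : R) := cc (A t); pose d (t : R) := cd (A t).
pose a1 (t : R) := ca (derive1 A t); pose b1 (t : R) := cb (derive1 A t).
pose c1 (t : R) := cc (derive1 A t); pose d1 (t : R) := cd (derive1 A t).
pose hp (t : R) := lambda t - kappa.
pose hq (t : R) := - (lambda t + kappa).
have dabcd (t : R) : [/\ is_derive t 1 a (a1 t), is_derive t 1 b (b1 t),
    is_derive t 1 c (c1 t) & is_derive t 1 d (d1 t)] := is_derive_coord (dA t).
have da (t : R) : is_derive t 1 a (a1 t) by case: (dabcd t).
have db (t : R) : is_derive t 1 b (b1 t) by case: (dabcd t).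
have dc (t : R) : is_derive t 1 c (c1 t) by case: (dabcd t).
have dd (t : R) : is_derive t 1 d (d1 t) by case: (dabcd t).
have A2E (t : R) : derive1 (derive1 A) t =
    cmx (hp t * a t) (hp t * b t) (hq t * c t) (hq t * d t).
  rewrite -[LHS]/(derive1n 2 A t).
  have /(congr1 (fun M => M - kappa *: A t)) := sol t; rewrite addrK => ->.
  rewrite cofmx_coord -[X in kappa *: X](cmx_coord (A t)).
  by apply: mx2P; rewrite !mxE /= /hp /hq /a /b /c /d; ring.
have dabcd1 (t : R) : [/\ is_derive t 1 a1 (hp t * a t), is_derive t 1 b1 (hp t * b t),
    is_derive t 1 c1 (hq t * c t) & is_derive t 1 d1 (hq t * d t)].
  have := is_derive_coord (dA1 t).
  by rewrite A2E ca_cmx cb_cmx cc_cmx cd_cmx.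
have da1 (t : R) : is_derive t 1 a1 (hp t * a t) by case: (dabcd1 t).
have db1 (t : R) : is_derive t 1 b1 (hp t * b t) by case: (dabcd1 t).
have dc1 (t : R) : is_derive t 1 c1 (hq t * c t) by case: (dabcd1 t).
have dd1 (t : R) : is_derive t 1 d1 (hq t * d t) by case: (dabcd1 t).
pose m (t : R) := a t * a t + b t * b t.
pose n (t : R) := c t * c t + d t * d t.
have mE (t : R) : m t = 1 + n t := SL2_coord (A_SL2 t).
have n_ge0 (t : R) : 0 <= n t by rewrite /n -!expr2 addr_ge0 ?sqr_ge0.
have m_gt0 (t : R) : 0 < m t by rewrite mE; have := n_ge0 t; lra.
have normE (t : R) : mxnorm (A t) ^+ 2 = 2 * (m t + n t).
  by rewrite mxnorm_coord /m /n /a /b /c /d; ring.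
have nT : periodic n T.
  by move=> t; have := normE (t + T); rewrite (normA_periodic t) normE !mE; lra.
have mT : periodic m T by move=> t; rewrite !mE nT.
(* The angular momenta of [p] and [q]. *)
pose Yp (t : R) := a t * b1 t - b t * a1 t.
pose Yq (t : R) := c t * d1 t - d t * c1 t.
have Yp_cst (t : R) : Yp t = Yp 0.
  by apply: is_derive_0_is_cst => s; rewrite /Yp; der; ring.
have Yq_cst (t : R) : Yq t = Yq 0.
  by apply: is_derive_0_is_cst => s; rewrite /Yq; der; ring.
have X3E (t : R) : X3 (A t) (derive1 A t) = 2 * Yp t := X3_coord _ _.
have X2E (t : R) : X2 (A t) (derive1 A t) = 2 * Yq t := X2_coord _ _.
split; first by move=> t; rewrite !X2E Yq_cst.
split; first by move=> t; rewrite !X3E Yp_cst.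
set om1 := omega1 A T; set om2 := omega2 A T.
pose Ahat (t : R) := Umx (- (2^-1 * (om1 + om2) * t)) *m A t
                     *m Umx (- (2^-1 * (om1 - om2) * t)).
have AhatE (t : R) : Ahat t =
    cmx (rot1 (- (om1 * t)) (a t) (b t)) (rot2 (- (om1 * t)) (a t) (b t))
        (rot1 (- (om2 * t)) (c t) (d t)) (rot2 (- (om2 * t)) (c t) (d t)).
  rewrite /Ahat -(cmx_coord (A t)) rot_cmx.
  by congr (cmx (rot1 _ _ _) (rot2 _ _ _) (rot1 _ _ _) (rot2 _ _ _)); field.
exists Ahat; split.
  move=> t; rewrite /Ahat !mulmxA mul_UmxN mul1mx -mulmxA.
  by rewrite -{2}[_ * t]opprK mul_UmxN mulmx1.
have [pT1 pT2] : periodic (fun t => rot1 (- (om1 * t)) (a t) (b t)) T /\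
    periodic (fun t => rot2 (- (om1 * t)) (a t) (b t)) T.
  apply: rotating_frame_periodic.
  have -> : om1 * T = \int[lebesgue_measure]_(t in `[0, T]%classic) (Yp 0 / m t).
    rewrite /om1 /omega1 mulrAC mulVf ?mul1r ?gt_eqF//.
    apply: eq_Rintegral => t _.
    rewrite X3E Yp_cst normE (_ : _ + 1 = 2 * m t); last by rewrite mE; field.
    by rewrite -mulf_div divff ?mul1r.
  exact: (@angular_shift _ a b a1 b1).
split=> [noSO|[t0 SOt0]].
  have n_gt0 (t : R) : 0 < n t.
    rewrite lt_neqAle n_ge0 andbT eq_sym; apply/eqP => n0.
    by apply: (noSO t); apply/(SO2_coord (A_SL2 t)).
  (* When [Yq = 0] the integral is zero as well, so the same argument covers both
     cases of [omega2]. *)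
  have [qT1 qT2] : periodic (fun t => rot1 (- (om2 * t)) (c t) (d t)) T /\
      periodic (fun t => rot2 (- (om2 * t)) (c t) (d t)) T.
    apply: rotating_frame_periodic.
    have -> : om2 * T = \int[lebesgue_measure]_(t in `[0, T]%classic) (Yq 0 / n t).
      rewrite /om2 /omega2; case: ifPn => [|_].
        rewrite X2E mulf_eq0 pnatr_eq0 => /eqP Y0.
        rewrite Y0; under eq_Rintegral do rewrite mul0r.
        by rewrite Rintegral_cst// !mul0r.
      rewrite mulrAC mulVf ?mul1r ?gt_eqF//.
      apply: eq_Rintegral => t _.
      rewrite X2E Yq_cst normE (_ : _ - 1 = 2 * n t); last by rewrite mE; field.
      by rewrite -mulf_div divff ?mul1r.
    exact: (@angular_shift _ c d c1 d1).
  by move=> t; rewrite !AhatE; congr cmx; [exact: pT1|exact: pT2|exact: qT1|exact: qT2].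
have n0 : n t0 = 0 := (SO2_coord (A_SL2 t0)).1 SOt0.
have [c0 d0] := sum_sqr_eq0 n0.
have om20 : om2 = 0.
  by rewrite /om2 /omega2 X2E -(Yq_cst t0) /Yq c0 d0 !mul0r subr0 mulr0 eqxx.
(* [hp] is determined by [m], its first two derivatives and the momentum [Yp],
   through [m'' = 2 |p'|^2 + 2 hp m] and [4 m |p'|^2 = m'^2 + 4 Yp^2]. *)
have hqT : periodic hq T.
  have dm (t : R) : is_derive t 1 m (2 * (a t * a1 t + b t * b1 t)).
    by rewrite /m; der; ring.
  have dm1 (t : R) : is_derive t 1 (fun t : R => 2 * (a t * a1 t + b t * b1 t))
      (2 * (a1 t * a1 t + b1 t * b1 t + hp t * m t)).
    by rewrite /m; der; ring.
  have m1T := periodic_derive dm mT; have m2T := periodic_derive dm1 m1T.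
  have speed (t : R) : 4 * m t * (a1 t * a1 t + b1 t * b1 t) =
      (2 * (a t * a1 t + b t * b1 t)) ^+ 2 + 4 * Yp 0 ^+ 2.
    by rewrite -(Yp_cst t) /Yp /m; ring.
  move=> t; have hpT : hp (t + T) = hp t.
    have mm : m t != 0 by rewrite gt_eqF.
    have sp : 4 * m t * (a1 (t + T) * a1 (t + T) + b1 (t + T) * b1 (t + T)) =
        4 * m t * (a1 t * a1 t + b1 t * b1 t).
      by rewrite -{1}(mT t) !speed m1T.
    have mm4 : 4 * m t != 0 by rewrite mulf_neq0.
    apply: (mulIf mm); have := m2T t; move/(mulfI mm4): sp => ->.
    by rewrite (mT t); lra.
  by move: hpT; rewrite /hp /hq; lra.
have chq : continuous hq.
  by move=> t; apply: cvgN; apply: cvgD; [exact: clambda|exact: cvg_cst].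
have [cT dT] := ode2_double_period chq hqT dc dd dc1 dd1 nT c0 d0.
move=> t; rewrite !AhatE om20 !mul0r cT dT.
rewrite (_ : t + 2 * T = t + T + T); last by ring.
by congr cmx; [rewrite (pT1 (t + T)); exact: pT1|rewrite (pT2 (t + T)); exact: pT2].
Qed.
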